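(* For every integer $n\in\{1,2,3,4,5,6\}$ there exist a real number $k>0$ and a point $w\in\mathbf{C}$ such that the equation $$z-\frac{k}{\sin\overline{z}}=w$$ has exactly $n$ solutions $z$ in the region $|\operatorname{Re} z|<\pi/2$.
   Context: Solutions are complex numbers $z\neq 0$ with $|\operatorname{Re} z|<\pi/2$ satisfying the equation (at $z=0$ the left-hand side has a pole, so $z=0$ is not a solution). The number of solutions counts distinct points $z$. *)

(* Defs.v *)
From Stdlib Require Import Reals List.
From Coquelicot Require Import Coquelicot.

Definition Cexp (z : C) : C :=
  (exp (Re z) * cos (Im z), exp (Re z) * sin (Im z))%R.

Definition Csin (z : C) : C :=
  ((Cexp (Ci * z) - Cexp (- (Ci * z))) / (2 * Ci))%C.

(* Division in [C] is total, so the pole [z = 0] has to be excluded explicitly.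
   It is the only zero of [Csin (Cconj z)] in the strip. *)
Definition is_solution (k : R) (w z : C) : Prop :=
  z <> RtoC 0 /\
  (Rabs (Re z) < PI / 2)%R /\
  (z - RtoC k / Csin (Cconj z))%C = w.

Definition exactly {T : Type} (n : nat) (P : T -> Prop) : Prop :=
  exists l : list T, NoDup l /\ length l = n /\ (forall x : T, In x l <-> P x).

(* Main.v *)
Require Import Defs.
From Stdlib Require Import Reals List.
From Stdlib Require Import Lra Lia Psatz Ranalysis5 Machin.
From Coquelicot Require Import Coquelicot.
Import ListNotations.
Local Open Scope R_scope.

(** Write z = x + i y and w = u + i v.  For fixed y > 0 the imaginary part of
the equation is a quadratic equation for cos x, with exactly one positive root.
So the solutions with y > 0 lie on the two curves x = branch_x k v y and
x = - branch_x k v y, and they correspond to the points where the real part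
along the first curve, a function branch_re k v of y alone, takes the value u
or - u.  Conjugating z and w reduces y < 0 to y > 0, with v replaced by - v.

A critical point of branch_re is a point of the curve where the map
z |-> z - k / sin (conj z) has vanishing Jacobian (critical_eq).  If v <= 0,
there is none (lower_no_critical), so branch_re is injective.  This gives exact
counts for real w, where both half-planes are of this kind, and yields n = 1,
2, 3 and 4; the real solutions are read off from the increasing function
(x + u) sin x.

If v > 0 and k < 2, there are at most two critical points
(upper_critical_points).  Indeed the critical curve of the map is explicit in
terms of R = |cos z|, its image has imaginary part caustic_height k R, and the
derivative of that function vanishes only if T = R^2 satisfies
(T - 1)^3 = (4 - k^2) T, an equation with only one positive root.  Rolle's
theorem then bounds how often caustic_height takes the value v.

For k = 5 PI / 8 and v = ln 2 the boundary point PI / 2 + i ln 2 of the strip is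
mapped to i ln 2.  Then branch_re vanishes at both ends of the upper curve, and
it takes negative values and, later, positive ones.  With at most two critical
points, every small u > 0 is taken exactly twice, and so is - u (two_bumps).
The lower half-plane contributes one more solution, so there are 5.

If k is slightly smaller and u = 0, the initial value of branch_re becomes
positive, so that branch_re has exactly two zeros before the end of the curve
(two_zeros).  Each gives two solutions, symmetric about the imaginary axis,
and there is one more solution on that axis in each half-plane, so there are
6. *)

(** * The equation in real coordinates *)

Lemma cosh2 y : cosh y ^ 2 = 1 + sinh y ^ 2.
Proof.
unfold cosh, sinh.
assert (E : exp y * exp (- y) = 1).
{ rewrite <- exp_plus, Rplus_opp_r. apply exp_0. }
nra.
Qed.

Lemma sincos2 x : sin x ^ 2 + cos x ^ 2 = 1.
Proof. generalize (sin2_cos2 x); unfold Rsqr; lra. Qed.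

Lemma cosh_pos y : 0 < cosh y.
Proof. unfold cosh; generalize (exp_pos y) (exp_pos (- y)); lra. Qed.

Lemma sinh_opp y : sinh (- y) = - sinh y.
Proof. unfold sinh; rewrite Ropp_involutive; lra. Qed.

Lemma cosh_opp y : cosh (- y) = cosh y.
Proof. unfold cosh; rewrite Ropp_involutive; lra. Qed.

Lemma sinh_pos y : 0 < y -> 0 < sinh y.
Proof. intro H; rewrite <- sinh_0; now apply sinh_lt. Qed.

Lemma sinh_neq0 y : y <> 0 -> sinh y <> 0.
Proof.
intro H; destruct (Rtotal_order y 0) as [h|[h|h]]; try easy.
- assert (0 < sinh (- y)) by (apply sinh_pos; lra). rewrite sinh_opp in *; lra.
- generalize (sinh_pos y h); lra.
Qed.

Definition den x y := sin x ^ 2 + sinh y ^ 2.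
Definition lens1 k x y := x - k * sin x * cosh y / den x y.
Definition lens2 k x y := y - k * cos x * sinh y / den x y.

Lemma sin_neq0 x : Rabs x < PI / 2 -> x <> 0 -> sin x <> 0.
Proof.
intros hx nx. apply Rabs_def2 in hx. generalize PI_RGT_0; intro.
destruct (Rtotal_order x 0) as [h|[h|h]]; try easy.
- assert (0 < sin (- x)) by (apply sin_gt_0; lra). rewrite sin_neg in *; lra.
- assert (0 < sin x) by (apply sin_gt_0; lra). lra.
Qed.

Lemma den_pos x y : Rabs x < PI / 2 -> (x, y) <> (0, 0) -> 0 < den x y.
Proof.
intros hx n. unfold den.
generalize (pow2_ge_0 (sin x)) (pow2_ge_0 (sinh y)); intros.
destruct (Req_dec x 0) as [->|nx].
- assert (y <> 0) by congruence.
  generalize (pow2_gt_0 _ (sinh_neq0 _ H1)); lra.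
- generalize (pow2_gt_0 _ (sin_neq0 _ hx nx)); lra.
Qed.

Lemma Csin_conj x y : Csin (Cconj (x, y)) = (sin x * cosh y, - (cos x * sinh y)).
Proof.
unfold Csin, Cexp, Cconj, Ci, Cdiv, Cinv, Cmult, Cminus, Cplus, Copp, cosh, sinh; simpl.
replace (0 * x - 1 * - y) with y by ring.
replace (0 * - y + 1 * x) with x by ring.
rewrite sin_neg, cos_neg.
apply injective_projections; simpl; field.
Qed.

Lemma is_solution_iff k u v x y :
  is_solution k (u, v) (x, y) <->
  (x, y) <> (0, 0) /\ Rabs x < PI / 2 /\ lens1 k x y = u /\ lens2 k x y = v.
Proof.
assert (key : (x, y) <> (0, 0) -> Rabs x < PI / 2 ->
   ((x, y) - RtoC k / Csin (Cconj (x, y)))%C = (lens1 k x y, lens2 k x y)).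
{ intros n hx. generalize (den_pos x y hx n). unfold lens1, lens2.
  rewrite Csin_conj. intro hD.
  assert (E : (sin x * cosh y) ^ 2 + (- (cos x * sinh y)) ^ 2 = den x y).
  { unfold den. generalize (cosh2 y) (sincos2 x). intros E1 E2.
    replace ((sin x * cosh y) ^ 2) with (sin x ^ 2 * cosh y ^ 2) by ring.
    rewrite E1. replace (sin x ^ 2) with (1 - cos x ^ 2) by lra. ring. }
  unfold Cdiv, Cinv, Cminus, Cplus, Copp, Cmult, RtoC. cbn [fst snd].
  rewrite E. f_equal; field; lra. }
unfold is_solution; simpl Re.
split.
- intros [n [hx h]]. unfold RtoC in n. specialize (key n hx).
  rewrite key in h. injection h; auto.
- intros [n [hx [h1 h2]]]. specialize (key n hx).
  rewrite key, h1, h2; auto.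
Qed.

(** * Counting the roots of functions with few critical points *)

Lemma rolle (f : R -> R) a b : a < b -> (forall x, a <= x <= b -> continuous f x) ->
  (forall x, a < x < b -> ex_derive f x) -> f a = f b ->
  exists c, a < c < b /\ is_derive f c 0.
Proof.
intros ab hc hd e.
assert (pr : forall x, a < x < b -> derivable_pt f x)
  by (intros x hx; apply ex_derive_Reals_0; auto).
destruct (Rolle f a b pr) as [c [P h]]; auto.
- intros x hx. apply continuity_pt_filterlim. now apply hc.
- exists c; split; auto. rewrite <- h. apply is_derive_Reals.
  apply (proj1 (derive_pt_eq f c _ (pr c P))). reflexivity.
Qed.

Lemma ivt_up (f : R -> R) a b y : a < b -> (forall x, a <= x <= b -> continuous f x) ->
  f a < y -> y < f b -> exists c, a < c < b /\ f c = y.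
Proof.
intros ab hc ha hb.
destruct (IVT_interv (fun x => f x - y) a b) as [c [h1 h2]]; try lra.
- intros x hx. apply continuity_pt_minus.
  + apply continuity_pt_filterlim. now apply hc.
  + apply continuity_pt_const. now intros ? ?.
- exists c. assert (f c = y) by lra. split; [|lra].
  destruct (Req_dec c a) as [->|]; [lra|].
  destruct (Req_dec c b) as [->|]; lra.
Qed.

Lemma ivt_down (f : R -> R) a b y : a < b -> (forall x, a <= x <= b -> continuous f x) ->
  y < f a -> f b < y -> exists c, a < c < b /\ f c = y.
Proof.
intros ab hc ha hb.
destruct (ivt_up (fun x => - f x) a b (- y)) as [c [h1 h2]]; try lra.
- intros x hx. apply (continuous_opp f). now apply hc.
- exists c; split; lra.
Qed.

Definition at_most_two_critical (f : R -> R) a b :=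
  forall x1 x2 x3, a < x1 -> x1 < x2 -> x2 < x3 -> x3 < b ->
  is_derive f x1 0 -> is_derive f x2 0 -> is_derive f x3 0 -> False.

Lemma at_most_three (f : R -> R) a b x0 x1 x2 x3 :
  (forall x, a <= x <= b -> continuous f x) ->
  (forall x, a < x < b -> ex_derive f x) -> at_most_two_critical f a b ->
  a <= x0 -> x0 < x1 -> x1 < x2 -> x2 < x3 -> x3 <= b ->
  f x0 = f x1 -> f x1 = f x2 -> f x2 = f x3 -> False.
Proof.
intros hc hd hf h0 h1 h2 h3 h4 e1 e2 e3.
destruct (rolle f x0 x1) as [c1 [p1 q1]]; auto; try (intros; (apply hc || apply hd); lra).
destruct (rolle f x1 x2) as [c2 [p2 q2]]; auto; try (intros; (apply hc || apply hd); lra).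
destruct (rolle f x2 x3) as [c3 [p3 q3]]; auto; try (intros; (apply hc || apply hd); lra).
apply (hf c1 c2 c3); auto; lra.
Qed.

(** The sign changes give two zeros; a third one would form, together with b,
four points at the same level. *)
Lemma two_zeros (f : R -> R) a p r b :
  (forall x, a <= x <= b -> continuous f x) ->
  (forall x, a < x < b -> ex_derive f x) -> at_most_two_critical f a b ->
  a < p -> p < r -> r < b -> 0 < f a -> f p < 0 -> 0 < f r -> f b = 0 ->
  exists z1 z2, a < z1 /\ z1 < z2 /\ z2 < b /\
   (forall x, a <= x < b -> (f x = 0 <-> x = z1 \/ x = z2)).
Proof.
intros hc hd hf ap pr rb fa fp fr fb.
destruct (ivt_down f a p 0) as [z1 [h1 e1]]; auto; try (intros; apply hc; lra).
destruct (ivt_up f p r 0) as [z2 [h2 e2]]; auto; try (intros; apply hc; lra).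
exists z1, z2. repeat split; try lra.
- intro fx. assert (x <> a) by (intros ->; lra).
  destruct (Rtotal_order x z1) as [l1|[l1|l1]]; auto.
  + exfalso; apply (at_most_three f a b x z1 z2 b); auto; lra.
  + destruct (Rtotal_order x z2) as [l2|[l2|l2]]; auto; exfalso.
    * apply (at_most_three f a b z1 x z2 b); auto; lra.
    * apply (at_most_three f a b z1 z2 x b); auto; lra.
- intros [->| ->]; auto.
Qed.

(** The level u is taken on either side of r; three points at that level would
be separated by two critical points. *)
Lemma bump_levels (f : R -> R) a r b u :
  (forall x, a <= x <= b -> continuous f x) ->
  (forall x, a < x < b -> ex_derive f x) ->
  (forall x1 x2, a < x1 -> x1 < x2 -> x2 < b ->
     is_derive f x1 0 -> is_derive f x2 0 -> False) ->
  a < r -> r < b -> f a = 0 -> f b = 0 -> 0 < u -> u < f r ->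
  exists z1 z2, a < z1 /\ z1 < z2 /\ z2 < b /\
   (forall x, a <= x <= b -> (f x = u <-> x = z1 \/ x = z2)).
Proof.
intros hc hd hf ar rb fa fb u0 fr.
destruct (ivt_up f a r u) as [z1 [h1 e1]]; auto; try (intros; apply hc; lra); try lra.
destruct (ivt_down f r b u) as [z2 [h2 e2]]; auto; try (intros; apply hc; lra); try lra.
assert (K : forall x1 x2 x3, a < x1 -> x1 < x2 -> x2 < x3 -> x3 < b ->
   f x1 = u -> f x2 = u -> f x3 = u -> False).
{ intros x1 x2 x3 l1 l2 l3 l4 d1 d2 d3.
  destruct (rolle f x1 x2) as [c1 [p1 q1]]; try lra; try (intros; (apply hc || apply hd); lra).
  destruct (rolle f x2 x3) as [c2 [p2 q2]]; try lra; try (intros; (apply hc || apply hd); lra).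
  apply (hf c1 c2); auto; lra. }
exists z1, z2. repeat split; try lra.
- intro fx. assert (x <> a) by (intros ->; lra). assert (x <> b) by (intros ->; lra).
  destruct (Rtotal_order x z1) as [l1|[l1|l1]]; auto.
  + exfalso; apply (K x z1 z2); auto; lra.
  + destruct (Rtotal_order x z2) as [l2|[l2|l2]]; auto; exfalso.
    * apply (K z1 x z2); auto; lra.
    * apply (K z1 z2 x); auto; lra.
- intros [->| ->]; auto.
Qed.

Lemma is_derive_opp_0 (f : R -> R) x : is_derive (fun t => - f t) x 0 -> is_derive f x 0.
Proof.
intro h. apply (is_derive_ext (fun t => - - f t)); [intro; apply Ropp_involutive|].
rewrite <- Ropp_0. now apply (is_derive_opp (fun t => - f t)).
Qed.

(** Four zeros of f would be separated by three critical points, so f has a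
single zero z between a and b.  Rolle's theorem gives one critical point on
either side of z; hence neither side has two of them, and bump_levels applies
to - f before z and to f after z. *)
Lemma two_bumps (f : R -> R) a p r b :
  (forall x, a <= x <= b -> continuous f x) ->
  (forall x, a < x < b -> ex_derive f x) -> at_most_two_critical f a b ->
  a < p -> p < r -> r < b -> f a = 0 -> f p < 0 -> 0 < f r -> f b = 0 ->
  forall u, 0 < u -> u < - f p -> u < f r ->
  exists z1 z2 z3 z4, a < z1 /\ z1 < z2 /\ z2 < z3 /\ z3 < z4 /\ z4 < b /\
   (forall x, a <= x <= b -> (f x = - u <-> x = z1 \/ x = z2)) /\
   (forall x, a <= x <= b -> (f x = u <-> x = z3 \/ x = z4)).
Proof.
intros hc hd hf ap pr rb fa fp fr fb u u0 up ur.
destruct (ivt_up f p r 0) as [z [hz ez]]; auto; try (intros; apply hc; lra).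
assert (Z : forall x, a < x < b -> f x = 0 -> x = z).
{ intros x hx ex. destruct (Rtotal_order x z) as [l1|[l1|l1]]; auto; exfalso.
  + apply (at_most_three f a b a x z b); auto; lra.
  + apply (at_most_three f a b a z x b); auto; lra. }
(* cl and cr are one critical point on each side of z *)
destruct (rolle f a z) as [cl [pl ql]]; try lra; try (intros; (apply hc || apply hd); lra).
destruct (rolle f z b) as [cr [pr' qr]]; try lra; try (intros; (apply hc || apply hd); lra).
destruct (bump_levels (fun x => - f x) a p z u) as [z1 [z2 [h1 [h2 [h3 E1]]]]]; try lra.
- intros x hx; apply (continuous_opp f), hc; lra.
- intros x hx; apply (ex_derive_opp f), hd; lra.
- intros x1 x2 l1 l2 l3 d1 d2.
  apply (hf x1 x2 cr); try lra; auto; now apply is_derive_opp_0.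
- destruct (bump_levels f z r b u) as [z3 [z4 [h4 [h5 [h6 E2]]]]]; try lra.
  + intros x hx; apply hc; lra.
  + intros x hx; apply hd; lra.
  + intros x1 x2 l1 l2 l3 d1 d2. apply (hf cl x1 x2); try lra; auto.
  + exists z1, z2, z3, z4. repeat (split; [lra|]). split; intros x hx.
    * destruct (Rle_lt_dec x z) as [l|l].
      -- rewrite <- (E1 x) by lra. split; lra.
      -- split; [intro e; exfalso | intros [->| ->]; lra].
         destruct (Rlt_le_dec x r) as [l'|l'].
         ++ destruct (ivt_up f x r 0) as [t [ht et]]; auto; try lra; try (intros; apply hc; lra).
            apply Z in et; lra.
         ++ assert (x <> r) by (intros ->; lra).
            destruct (ivt_down f r x 0) as [t [ht et]]; auto; try lra; try (intros; apply hc; lra).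
            apply Z in et; lra.
    * destruct (Rle_lt_dec z x) as [l|l].
      -- rewrite <- (E2 x) by lra. reflexivity.
      -- split; [intro e; exfalso | intros [->| ->]; lra].
         destruct (Rlt_le_dec x p) as [l'|l'].
         ++ destruct (ivt_down f x p 0) as [t [ht et]]; auto; try lra; try (intros; apply hc; lra).
            apply Z in et; lra.
         ++ assert (x <> p) by (intros ->; lra).
            destruct (ivt_up f p x 0) as [t [ht et]]; auto; try lra; try (intros; apply hc; lra).
            apply Z in et; lra.
Qed.

(** * The curves on which the imaginary part is constant *)

Lemma is_derive_cosh y : is_derive cosh y (sinh y).
Proof. apply is_derive_Reals, derivable_pt_lim_cosh. Qed.
Lemma is_derive_sinh y : is_derive sinh y (cosh y).
Proof. apply is_derive_Reals, derivable_pt_lim_sinh. Qed.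

Lemma cosh_ge1 y : 1 <= cosh y.
Proof. generalize (pow2_ge_0 (sinh y)) (cosh2 y) (cosh_pos y). nra. Qed.

Lemma lens1_oppx k x y : lens1 k (- x) y = - lens1 k x y.
Proof.
unfold lens1, den. rewrite sin_neg.
replace ((- sin x) ^ 2) with (sin x ^ 2) by ring. unfold Rdiv; ring.
Qed.
Lemma lens1_oppy k x y : lens1 k x (- y) = lens1 k x y.
Proof.
unfold lens1, den. rewrite sinh_opp, cosh_opp.
replace ((- sinh y) ^ 2) with (sinh y ^ 2) by ring. reflexivity.
Qed.
Lemma lens2_oppy k x y : lens2 k x (- y) = - lens2 k x y.
Proof.
unfold lens2, den. rewrite sinh_opp.
replace ((- sinh y) ^ 2) with (sinh y ^ 2) by ring. unfold Rdiv; ring.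
Qed.


(** The root c of (y - v) c^2 + k sinh y c - (y - v) cosh y ^ 2 = 0 that has the
sign of y - v.  The rationalised form remains regular at y = v, where the
equation degenerates and c = 0. *)
Definition branch_cos k v y :=
  2 * (y - v) * cosh y ^ 2 /
  (k * sinh y + sqrt (k ^ 2 * sinh y ^ 2 + 4 * (y - v) ^ 2 * cosh y ^ 2)).

(** The arc cosine of branch_cos.  The half-angle form makes continuity visible up to
the end of the curve, where branch_cos = 1. *)
Definition branch_x k v y := 2 * atan (sqrt ((1 - branch_cos k v y) / (1 + branch_cos k v y))).
Definition branch_re k v y := lens1 k (branch_x k v y) y.

Lemma branch_cos_den k v y : 0 < k -> 0 < y ->
  0 < k * sinh y + sqrt (k ^ 2 * sinh y ^ 2 + 4 * (y - v) ^ 2 * cosh y ^ 2).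
Proof.
intros hk hy. generalize (sqrt_pos (k ^ 2 * sinh y ^ 2 + 4 * (y - v) ^ 2 * cosh y ^ 2)).
assert (0 < k * sinh y) by (apply Rmult_lt_0_compat; auto; now apply sinh_pos).
lra.
Qed.

Lemma branch_cos_arg k v y : 0 < k -> 0 < y ->
  0 < k ^ 2 * sinh y ^ 2 + 4 * (y - v) ^ 2 * cosh y ^ 2.
Proof.
intros hk hy. generalize (sinh_pos y hy) (cosh_pos y). intros.
assert (0 < k ^ 2 * sinh y ^ 2) by (apply Rmult_lt_0_compat; apply pow_lt; auto).
assert (0 <= 4 * (y - v) ^ 2 * cosh y ^ 2)
  by (replace (4 * (y - v) ^ 2 * cosh y ^ 2) with ((2 * (y - v) * cosh y) ^ 2) by ring;
      apply pow2_ge_0).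
lra.
Qed.

Lemma branch_cos_quad k v y : 0 < k -> 0 < y ->
  (y - v) * branch_cos k v y ^ 2 + k * sinh y * branch_cos k v y - (y - v) * cosh y ^ 2 = 0.
Proof.
intros hk hy. generalize (branch_cos_den k v y hk hy) (branch_cos_arg k v y hk hy). unfold branch_cos.
set (w := sqrt _). intros hd ha.
assert (hw : w ^ 2 = k ^ 2 * sinh y ^ 2 + 4 * (y - v) ^ 2 * cosh y ^ 2)
  by (apply pow2_sqrt; lra).
set (q := y - v) in *. set (S := sinh y) in *. set (C := cosh y) in *.
replace (q * (2 * q * C ^ 2 / (k * S + w)) ^ 2 +
    k * S * (2 * q * C ^ 2 / (k * S + w)) - q * C ^ 2)
 with (q * C ^ 2 * (k ^ 2 * S ^ 2 + 4 * q ^ 2 * C ^ 2 - w ^ 2) / (k * S + w) ^ 2)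
 by (field; lra).
rewrite hw. unfold Rdiv; ring.
Qed.

Lemma branch_cos_pos k v y : 0 < k -> 0 < y -> v < y -> 0 < branch_cos k v y.
Proof.
intros hk hy hv. unfold branch_cos. apply Rdiv_lt_0_compat.
- generalize (pow_lt _ 2 (cosh_pos y)). nra.
- now apply branch_cos_den.
Qed.

Lemma branch_cos_uniq k v y c : 0 < k -> 0 < y -> v < y -> 0 < c ->
  (y - v) * c ^ 2 + k * sinh y * c - (y - v) * cosh y ^ 2 = 0 -> c = branch_cos k v y.
Proof.
intros hk hy hv hc e.
generalize (branch_cos_quad k v y hk hy) (branch_cos_pos k v y hk hy hv) (sinh_pos y hy).
set (d := branch_cos k v y). intros e' hd hS.
assert (h : (c - d) * ((y - v) * (c + d) + k * sinh y) = 0) by nra.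
apply Rmult_integral in h. destruct h; [lra|].
assert (0 < (y - v) * (c + d)) by (apply Rmult_lt_0_compat; lra).
assert (0 < k * sinh y) by (apply Rmult_lt_0_compat; lra). lra.
Qed.

(** At c = 1 the quadratic polynomial has the value
sinh y (k - (y - v) sinh y), and it increases for c >= 0. *)
Lemma branch_cos_sub1 k v y : 0 < k -> 0 < y -> v <= y ->
  exists m, 0 < m /\ branch_cos k v y - 1 = m * sinh y * ((y - v) * sinh y - k).
Proof.
intros hk hy hv.
generalize (branch_cos_quad k v y hk hy) (sinh_pos y hy) (cosh2 y). intros e hS h2.
assert (hc : 0 <= branch_cos k v y).
{ destruct (Req_dec v y) as [->|]; [|left; apply branch_cos_pos; lra].
  unfold branch_cos, Rdiv. rewrite Rminus_diag. rewrite Rmult_0_r, !Rmult_0_l; lra. }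
set (c := branch_cos k v y) in *.
assert (hp : 0 < (y - v) * (c + 1) + k * sinh y).
{ assert (0 <= (y - v) * (c + 1)) by (apply Rmult_le_pos; lra).
  assert (0 < k * sinh y) by (apply Rmult_lt_0_compat; lra). lra. }
exists (/ ((y - v) * (c + 1) + k * sinh y)). split; [now apply Rinv_0_lt_compat|].
apply Rmult_eq_reg_l with ((y - v) * (c + 1) + k * sinh y); [|lra].
replace (((y - v) * (c + 1) + k * sinh y) *
  (/ ((y - v) * (c + 1) + k * sinh y) * sinh y * ((y - v) * sinh y - k)))
  with (sinh y * ((y - v) * sinh y - k)) by (field; lra).
rewrite h2 in e. nra.
Qed.

Lemma branch_cos_le1 k v y : 0 < k -> 0 < y -> v <= y -> (branch_cos k v y <= 1 <-> (y - v) * sinh y <= k).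
Proof.
intros hk hy hv. destruct (branch_cos_sub1 k v y hk hy hv) as [m [hm e]].
generalize (sinh_pos y hy); intro hS. assert (0 < m * sinh y) by nra.
split; intro h; nra.
Qed.

Lemma branch_cos_lt1 k v y : 0 < k -> 0 < y -> v <= y -> (branch_cos k v y < 1 <-> (y - v) * sinh y < k).
Proof.
intros hk hy hv. destruct (branch_cos_sub1 k v y hk hy hv) as [m [hm e]].
generalize (sinh_pos y hy); intro hS. assert (0 < m * sinh y) by nra.
split; intro h; nra.
Qed.

Lemma cos_branch_x k v y : -1 < branch_cos k v y <= 1 -> cos (branch_x k v y) = branch_cos k v y.
Proof.
intro h. unfold branch_x. rewrite cos_2a_cos, cos_atan.
set (c := branch_cos k v y) in *.
assert (0 <= (1 - c) / (1 + c)) by (apply Rle_div_r; lra).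
assert (E : sqrt ((1 - c) / (1 + c)) ^ 2 = (1 - c) / (1 + c)) by (now apply pow2_sqrt).
assert (F : (1 / sqrt (1 + (sqrt ((1 - c) / (1 + c)))²)) ^ 2 = (1 + c) / 2).
{ unfold Rdiv at 1. rewrite Rpow_mult_distr, pow_inv, pow2_sqrt;
  unfold Rsqr; replace (sqrt ((1 - c) / (1 + c)) * sqrt ((1 - c) / (1 + c))) with
   (sqrt ((1 - c) / (1 + c)) ^ 2) by ring; rewrite E; [field; lra|lra]. }
set (t := 1 / sqrt _) in *.
replace (2 * t * t - 1) with (2 * t ^ 2 - 1) by ring.
rewrite F. field.
Qed.

Lemma branch_x_range k v y : 0 <= branch_x k v y < PI.
Proof.
unfold branch_x. generalize (atan_bound (sqrt ((1 - branch_cos k v y) / (1 + branch_cos k v y)))).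
assert (0 <= atan (sqrt ((1 - branch_cos k v y) / (1 + branch_cos k v y)))).
{ rewrite <- atan_0. destruct (sqrt_pos ((1 - branch_cos k v y) / (1 + branch_cos k v y))) as [h| <-].
  - left; now apply atan_increasing.
  - right; auto. }
lra.
Qed.

Lemma branch_x_lt k v y : 0 < branch_cos k v y <= 1 -> branch_x k v y < PI / 2.
Proof.
intro h. destruct (branch_x_range k v y) as [h1 h2].
apply Rnot_le_lt. intro n.
assert (cos (branch_x k v y) <= 0) by (apply cos_le_0; lra).
rewrite cos_branch_x in H; lra.
Qed.

Lemma den_cos x y : den x y = cosh y ^ 2 - cos x ^ 2.
Proof. unfold den. generalize (cosh2 y) (sincos2 x). lra. Qed.

Lemma den_posy x y : 0 < y -> 0 < den x y.
Proof.
intro h. unfold den. generalize (pow2_ge_0 (sin x)) (pow_lt _ 2 (sinh_pos y h)). lra.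
Qed.

(** Multiply by the denominator, which is cosh y ^ 2 - cos x ^ 2. *)
Lemma lens2_level k x y v : 0 < y ->
  (lens2 k x y = v <-> (y - v) * cos x ^ 2 + k * sinh y * cos x - (y - v) * cosh y ^ 2 = 0).
Proof.
intro hy. generalize (den_posy x y hy) (den_cos x y). unfold lens2. intros hD eD.
split.
- intros <-. rewrite eD in *. field. lra.
- intro e. apply Rmult_eq_reg_r with (den x y); [|lra].
  field_simplify; [|lra]. rewrite eD in *. lra.
Qed.

Lemma cos_pos_strip x : Rabs x < PI / 2 -> 0 < cos x.
Proof. intro h. apply Rabs_def2 in h. apply cos_gt_0; lra. Qed.

Lemma cos_Rabs x : cos (Rabs x) = cos x.
Proof. unfold Rabs; destruct (Rcase_abs x); auto. apply cos_neg. Qed.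

(** In the strip cos x is positive, so it must be the positive root of the
quadratic equation; the inequality says that this root is at most 1. *)
Lemma branch_iff k v x y : 0 < k -> 0 < y -> v < y -> Rabs x < PI / 2 ->
  (lens2 k x y = v <-> (y - v) * sinh y <= k /\ Rabs x = branch_x k v y).
Proof.
intros hk hy hv hx. rewrite lens2_level by auto.
generalize (branch_cos_le1 k v y hk hy (Rlt_le _ _ hv)) (branch_cos_pos k v y hk hy hv). intros l1 l0.
split.
- intro e. apply branch_cos_uniq in e; auto; [|now apply cos_pos_strip].
  assert (branch_cos k v y <= 1) by (rewrite <- e; apply COS_bound).
  split; [tauto|].
  generalize (branch_x_range k v y); intro. generalize PI_RGT_0; intro. generalize (Rabs_pos x); intro.
  apply cos_inj; try lra. rewrite cos_Rabs, cos_branch_x; lra.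
- intros [h e]. assert (E : cos x = branch_cos k v y).
  { rewrite <- cos_Rabs, e. apply cos_branch_x. split; [lra|tauto]. }
  rewrite E. now apply branch_cos_quad.
Qed.

Lemma branch_x_end k v y : branch_cos k v y = 1 -> branch_x k v y = 0.
Proof.
intro h. unfold branch_x. rewrite h, Rminus_diag. unfold Rdiv; rewrite Rmult_0_l, sqrt_0, atan_0. ring.
Qed.

Lemma branch_x_pos k v y : -1 < branch_cos k v y < 1 -> 0 < branch_x k v y.
Proof.
intro h. destruct (branch_x_range k v y) as [[h1|h1] _]; auto.
assert (E : cos (branch_x k v y) = branch_cos k v y) by (apply cos_branch_x; lra).
rewrite <- h1, cos_0 in E. lra.
Qed.

Lemma branch_re_end k v y : branch_cos k v y = 1 -> branch_re k v y = 0.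
Proof.
intro h. unfold branch_re. rewrite branch_x_end; auto. unfold lens1; rewrite sin_0. unfold Rdiv; ring.
Qed.

Lemma ex_derive_branch_cos k v y : 0 < k -> 0 < y -> ex_derive (branch_cos k v) y.
Proof.
intros hk hy. generalize (branch_cos_den k v y hk hy) (branch_cos_arg k v y hk hy). intros h1 h2.
unfold branch_cos. auto_derive.
repeat split; try (eexists; apply is_derive_cosh); try (eexists; apply is_derive_sinh); try exact h2.
- intro e. match type of e with ?a = 0 => match type of h1 with 0 < ?b =>
   replace a with b in e by reflexivity end end. lra.
Qed.

Lemma ex_derive_branch_x k v y : 0 < k -> 0 < y -> -1 < branch_cos k v y < 1 -> ex_derive (branch_x k v) y.
Proof.
intros hk hy h. unfold branch_x. auto_derive.
repeat split; try (now apply ex_derive_branch_cos); try lra.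
apply Rdiv_lt_0_compat; lra.
Qed.

Lemma continuous_branch_x k v y : 0 < k -> 0 < y -> -1 < branch_cos k v y -> continuous (branch_x k v) y.
Proof.
intros hk hy h. unfold branch_x.
apply (continuous_mult (fun _ => 2)); [apply continuous_const|].
apply (continuous_comp (fun y => sqrt ((1 - branch_cos k v y) / (1 + branch_cos k v y))) atan).
2: { apply (ex_derive_continuous atan). eexists. apply is_derive_atan. }
apply (continuous_comp (fun y => (1 - branch_cos k v y) / (1 + branch_cos k v y)) sqrt).
2: apply continuous_sqrt.
apply (ex_derive_continuous (fun y => (1 - branch_cos k v y) / (1 + branch_cos k v y))).
auto_derive. repeat split; try (now apply ex_derive_branch_cos); lra.
Qed.

Lemma continuous_branch_re k v y : 0 < k -> 0 < y -> -1 < branch_cos k v y -> continuous (branch_re k v) y.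
Proof.
intros hk hy h. unfold branch_re, lens1.
assert (hl := continuous_branch_x k v y hk hy h).
assert (hs : continuous (fun y => sin (branch_x k v y)) y).
{ apply (continuous_comp (branch_x k v) sin); auto.
  apply (ex_derive_continuous sin). auto_derive; auto. }
apply (continuous_minus (branch_x k v)); auto.
apply (continuous_mult (fun y => k * sin (branch_x k v y) * cosh y)).
- apply (continuous_mult (fun y => k * sin (branch_x k v y))).
  + apply (continuous_mult (fun _ => k)); auto. apply continuous_const.
  + apply (ex_derive_continuous cosh). eexists; apply is_derive_cosh.
- apply (continuous_comp (fun y => den (branch_x k v y) y) Rinv).
  + unfold den. apply (continuous_plus (fun y => sin (branch_x k v y) ^ 2)).
    * apply (continuous_comp (fun y => sin (branch_x k v y)) (fun t => t ^ 2)); auto.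
      apply (ex_derive_continuous (fun t => t ^ 2)). auto_derive; auto.
    * apply (ex_derive_continuous (fun y => sinh y ^ 2)). auto_derive.
      repeat split; eexists; apply is_derive_sinh.
  + apply continuous_Rinv. generalize (den_posy (branch_x k v y) y hy); lra.
Qed.

(** * Critical points along a curve *)

(** The derivative of z - k / sin (conj z) is dz plus
k cos (conj z) / sin (conj z) ^ 2 times the conjugate of dz.  Let a and b be
the real and imaginary parts of that factor: the Jacobian matrix of
(lens1, lens2) has the rows (1 + a, b) and (b, 1 - a). *)
Definition jac_a k x y :=
  k * cos x * cosh y * (sin x ^ 2 - sinh y ^ 2) / den x y ^ 2.
Definition jac_b k x y :=
  k * sin x * sinh y * (cosh y ^ 2 + cos x ^ 2) / den x y ^ 2.

Lemma jac_sq k x y : den x y <> 0 ->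
  jac_a k x y ^ 2 + jac_b k x y ^ 2 = k ^ 2 * (cos x ^ 2 + sinh y ^ 2) / den x y ^ 2.
Proof.
intro hD. unfold jac_a, jac_b.
assert (E : cos x ^ 2 * cosh y ^ 2 * (sin x ^ 2 - sinh y ^ 2) ^ 2 +
   sin x ^ 2 * sinh y ^ 2 * (cosh y ^ 2 + cos x ^ 2) ^ 2
   = (cos x ^ 2 + sinh y ^ 2) * den x y ^ 2).
{ unfold den. generalize (cosh2 y) (sincos2 x). intros -> E.
  replace (sin x ^ 2) with (1 - cos x ^ 2) by lra. ring. }
apply Rmult_eq_reg_r with (den x y ^ 4); [|now apply pow_nonzero].
transitivity (k ^ 2 * (cos x ^ 2 * cosh y ^ 2 * (sin x ^ 2 - sinh y ^ 2) ^ 2 +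
   sin x ^ 2 * sinh y ^ 2 * (cosh y ^ 2 + cos x ^ 2) ^ 2)).
- field; auto.
- rewrite E. field; auto.
Qed.

Lemma is_derive_lens1 k (f : R -> R) (y f' : R) : is_derive f y f' -> den (f y) y <> 0 ->
  is_derive (fun t => lens1 k (f t) t) y
    ((1 + jac_a k (f y) y) * f' + jac_b k (f y) y).
Proof.
intros hf hD. unfold lens1, den in *. auto_derive.
- assert (ex_derive (fun t : R => f t) y) by (exists f'; exact hf).
  assert (sin (f y) * (sin (f y) * 1) + sinh y * (sinh y * 1) <> 0)
    by (intro e; apply hD; rewrite <- e; ring).
  tauto.
- unfold jac_a, jac_b, den.
  replace (Derive (fun t : R => f t) y) with f'
    by (symmetry; apply is_derive_unique; exact hf).
  generalize (cosh2 y) (sincos2 (f y)).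
  set (s := sin (f y)) in *; set (c := cos (f y)) in *; set (S := sinh y) in *; set (C := cosh y) in *.
  intros E1 E2. 
  assert (E3 : C ^ 2 + c ^ 2 = 2 * C ^ 2 - (s ^ 2 + S ^ 2)) by lra.
  rewrite E3.
  field. auto.
Qed.

Lemma is_derive_lens2 k (f : R -> R) (y f' : R) : is_derive f y f' -> den (f y) y <> 0 ->
  is_derive (fun t => lens2 k (f t) t) y
    (jac_b k (f y) y * f' + (1 - jac_a k (f y) y)).
Proof.
intros hf hD. unfold lens2, den in *. auto_derive.
- assert (ex_derive (fun t : R => f t) y) by (exists f'; exact hf).
  assert (sin (f y) * (sin (f y) * 1) + sinh y * (sinh y * 1) <> 0)
    by (intro e; apply hD; rewrite <- e; ring).
  tauto.
- unfold jac_a, jac_b, den.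
  replace (Derive (fun t : R => f t) y) with f'
    by (symmetry; apply is_derive_unique; exact hf).
  generalize (cosh2 y) (sincos2 (f y)).
  set (s := sin (f y)) in *; set (c := cos (f y)) in *; set (S := sinh y) in *; set (C := cosh y) in *.
  intros E1 E2. 
  assert (E3 : C ^ 2 + c ^ 2 = 2 * c ^ 2 + (s ^ 2 + S ^ 2)) by lra.
  rewrite E3.
  field. auto.
Qed.

Lemma lens2_branch_x k v y : 0 < k -> 0 < y -> -1 < branch_cos k v y <= 1 -> lens2 k (branch_x k v y) y = v.
Proof.
intros hk hy h. apply lens2_level; auto. rewrite cos_branch_x by auto. now apply branch_cos_quad.
Qed.

(** The second equation is the derivative of the identity lens2 = v along the
curve. *)
Lemma branch_derive k v y : 0 < k -> 0 < y -> -1 < branch_cos k v y < 1 ->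
  let x := branch_x k v y in
  exists x', is_derive (branch_re k v) y ((1 + jac_a k x y) * x' + jac_b k x y) /\
    jac_b k x y * x' + (1 - jac_a k x y) = 0.
Proof.
intros hk hy h x. destruct (ex_derive_branch_x k v y hk hy h) as [x' hx'].
assert (hD : den (branch_x k v y) y <> 0) by (generalize (den_posy (branch_x k v y) y hy); lra).
exists x'. split.
- apply (is_derive_lens1 k (branch_x k v)); auto.
- assert (h1 := is_derive_lens2 k (branch_x k v) y x' hx' hD). fold x in h1.
  rewrite <- (is_derive_unique _ _ _ h1).
  apply is_derive_unique.
  (* near y the point stays on the curve, so that lens2 is locally constant *)
  apply is_derive_ext_loc with (fun _ => v); [|apply (is_derive_const v)].
  assert (hc : continuous (branch_cos k v) y)
    by (apply (ex_derive_continuous (branch_cos k v)); now apply ex_derive_branch_cos).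
  assert (L1 : locally y (fun t => -1 < branch_cos k v t))
    by (apply (hc (fun u => -1 < u)), (open_gt (-1)); lra).
  assert (L2 : locally y (fun t => branch_cos k v t < 1)) by (apply (hc (fun u => u < 1)), (open_lt 1); lra).
  assert (L3 : locally y (fun t => 0 < t)) by (apply (open_gt 0); lra).
  generalize (filter_and _ _ (filter_and _ _ L1 L2) L3). apply filter_imp.
  intros t [[t1 t2] t3]. symmetry. apply lens2_branch_x; lra.
Qed.

(** If both derivatives along the curve vanish, then the Jacobian
1 - a^2 - b^2 vanishes, and jac_sq evaluates it. *)
Lemma critical_eq k v y : 0 < k -> 0 < y -> -1 < branch_cos k v y < 1 -> is_derive (branch_re k v) y 0 ->
  (cosh y ^ 2 - branch_cos k v y ^ 2) ^ 2 = k ^ 2 * (branch_cos k v y ^ 2 + sinh y ^ 2).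
Proof.
intros hk hy h h0. destruct (branch_derive k v y hk hy h) as [x' [h1 h2]].
apply is_derive_unique in h0. apply is_derive_unique in h1. rewrite h0 in h1.
generalize (den_posy (branch_x k v y) y hy); intro hD.
assert (E := jac_sq k (branch_x k v y) y (Rgt_not_eq _ _ hD)).
set (a := jac_a k (branch_x k v y) y) in *. set (b := jac_b k (branch_x k v y) y) in *.
assert (E1 : a ^ 2 + b ^ 2 = 1).
{ assert (b * ((1 + a) * x' + b) - (1 + a) * (b * x' + (1 - a)) = 0) by (rewrite h2, <- h1; ring). nra. }
rewrite E1 in E. rewrite <- (cos_branch_x k v y) by lra. rewrite <- den_cos.
apply (f_equal (fun t => t * den (branch_x k v y) y ^ 2)) in E. field_simplify in E; [|lra].
lra.
Qed.

Lemma sinh_lt_mul_cosh y : 0 < y -> sinh y < y * cosh y.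
Proof.
intro hy.
destruct (MVT_cor2 (fun t => t * cosh t - sinh t) (fun t => t * sinh t) 0 y hy) as [c [e hc]].
- intros c _. apply is_derive_Reals. auto_derive; auto. ring.
- rewrite sinh_0, cosh_0 in e. assert (hs : 0 < sinh c) by (apply sinh_pos; lra).
  assert (0 < c * sinh c * (y - 0))
    by (apply Rmult_lt_0_compat; [apply Rmult_lt_0_compat|]; lra).
  lra.
Qed.

Lemma mul_cos_lt_sin x : 0 < x < PI -> x * cos x < sin x.
Proof.
intros hx.
destruct (MVT_cor2 (fun t => sin t - t * cos t) (fun t => t * sin t) 0 x (proj1 hx)) as [c [e hc]].
- intros c _. apply is_derive_Reals. auto_derive; auto. ring.
- rewrite sin_0, cos_0 in e. assert (hs : 0 < sin c) by (apply sin_gt_0; lra).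
  assert (0 < c * sin c * (x - 0)) by (repeat apply Rmult_lt_0_compat; lra).
  lra.
Qed.

Lemma branch_cos_interior k v y : 0 < k -> 0 < y -> v < y -> (y - v) * sinh y < k -> 0 < branch_cos k v y < 1.
Proof.
intros hk hy hv h. split; [now apply branch_cos_pos|]. apply branch_cos_lt1; auto; lra.
Qed.

Lemma mul_sinh_mono v y z : 0 < y -> v <= y -> y < z -> (y - v) * sinh y < (z - v) * sinh z.
Proof.
intros hy hv hz. generalize (sinh_pos y hy) (sinh_lt y z hz). intros. nra.
Qed.

(** By critical_eq and the quadratic equation for c = branch_cos k v y, a critical point
satisfies sinh y ^ 2 c^2 = (y - v)^2 (c^2 + sinh y ^ 2).  But the right-hand
side is larger, because c < 1, y - v >= y and sinh y < y cosh y. *)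
Lemma lower_no_critical k v y : 0 < k -> 0 < y -> v <= 0 -> (y - v) * sinh y < k ->
  ~ is_derive (branch_re k v) y 0.
Proof.
intros hk hy hv h hd.
destruct (branch_cos_interior k v y) as [c0 c1]; auto; try lra.
assert (hc : -1 < branch_cos k v y < 1) by lra.
assert (E := critical_eq k v y hk hy hc hd). 
generalize (branch_cos_quad k v y hk hy) (sinh_pos y hy) (cosh2 y) (cosh_pos y) (sinh_lt_mul_cosh y hy).
set (c := branch_cos k v y) in *. set (S := sinh y) in *. set (C := cosh y) in *.
intros Q hS h2 hC ht. 
set (q := y - v) in *. assert (hq : y <= q) by (unfold q; lra).
assert (E1 : q * (C ^ 2 - c ^ 2) = k * S * c) by lra.
assert (E2 : k ^ 2 * (S ^ 2 * c ^ 2) = k ^ 2 * (q ^ 2 * (c ^ 2 + S ^ 2))).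
{ transitivity ((q * (C ^ 2 - c ^ 2)) ^ 2); [rewrite E1; ring|].
  rewrite Rpow_mult_distr, E. ring. }
apply Rmult_eq_reg_l in E2; [|apply pow_nonzero; lra].
assert (F1 : S ^ 2 < y ^ 2 * C ^ 2) by nra.
assert (F2 : y ^ 2 <= q ^ 2) by nra.
assert (F3 : 0 < c ^ 2 < 1) by nra.
assert (F4 : y ^ 2 * (c ^ 2 + S ^ 2) <= q ^ 2 * (c ^ 2 + S ^ 2)) by (apply Rmult_le_compat_r; nra).
assert (F5 : y ^ 2 * (c ^ 2 * C ^ 2) <= y ^ 2 * (c ^ 2 + S ^ 2)).
{ apply Rmult_le_compat_l; [nra|]. rewrite h2. assert (0 < S ^ 2) by nra. nra. }
assert (F6 : c ^ 2 * S ^ 2 < c ^ 2 * (y ^ 2 * C ^ 2)) by (apply Rmult_lt_compat_l; lra).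
lra.
Qed.

Lemma lower_inj k v y1 y2 : 0 < k -> v <= 0 -> 0 < y1 -> y1 < y2 -> (y2 - v) * sinh y2 <= k ->
  branch_re k v y1 <> branch_re k v y2.
Proof.
intros hk hv h1 h12 h2 e.
assert (M : forall y, y1 <= y -> y < y2 -> (y - v) * sinh y < k).
{ intros y l l'. apply Rlt_le_trans with (2 := h2). apply mul_sinh_mono; lra. }
destruct (rolle (branch_re k v) y1 y2 h12) as [c [hc hd]]; auto.
- intros x hx. apply continuous_branch_re; try lra.
  apply Rlt_trans with 0; [lra|]. apply branch_cos_pos; lra.
- intros x hx.
  destruct (branch_derive k v x) as [x' [H _]]; try lra.
  + destruct (branch_cos_interior k v x); try lra. apply M; lra.
  + eexists; exact H.
- apply (lower_no_critical k v c) in hd; auto; try lra. apply M; lra.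
Qed.

(** The imaginary equation replaces k / den x y by
(y - v) / (cos x sinh y). *)
Lemma branch_re_eq k v y : 0 < k -> 0 < y -> 0 < branch_cos k v y <= 1 ->
  branch_re k v y = branch_x k v y - sin (branch_x k v y) * cosh y * (y - v) / (branch_cos k v y * sinh y).
Proof.
intros hk hy h. unfold branch_re, lens1.
generalize (den_posy (branch_x k v y) y hy) (branch_cos_quad k v y hk hy) (sinh_pos y hy).
rewrite den_cos, cos_branch_x by lra.
set (c := branch_cos k v y) in *. set (S := sinh y) in *. set (C := cosh y) in *.
set (s := sin _). set (q := y - v). intros hD Q hS.
assert (E : k / (C ^ 2 - c ^ 2) = q / (c * S)).
{ apply Rmult_eq_reg_r with ((C ^ 2 - c ^ 2) * (c * S));
    [|apply Rmult_integral_contrapositive_currified; nra].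
  field_simplify; [lra|lra|lra]. }
f_equal. 
replace (k * s * C / (C ^ 2 - c ^ 2)) with (s * C * (k / (C ^ 2 - c ^ 2))) by (unfold Rdiv; ring).
rewrite E. unfold Rdiv; ring.
Qed.

(** Here x < tan x, whereas (y - v) / tanh y > 1. *)
Lemma lower_neg k v y : 0 < k -> v <= 0 -> 0 < y -> (y - v) * sinh y < k -> branch_re k v y < 0.
Proof.
intros hk hv hy h. destruct (branch_cos_interior k v y) as [c0 c1]; auto; try lra.
rewrite branch_re_eq by lra.
destruct (branch_x_range k v y) as [_ hX]. assert (hX0 : 0 < branch_x k v y) by (apply branch_x_pos; lra).
generalize (mul_cos_lt_sin _ (conj hX0 hX)) (sinh_lt_mul_cosh y hy) (sinh_pos y hy) (cosh_pos y).
rewrite cos_branch_x by lra.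
set (c := branch_cos k v y) in *. set (S := sinh y) in *. set (C := cosh y) in *.
set (x := branch_x k v y) in *. set (s := sin _). set (q := y - v) in *. intros hs ht hS hC.
assert (hq : y <= q) by (unfold q; lra).
apply Rlt_minus. apply -> Rlt_div_r; [|apply Rmult_lt_0_compat; lra].
assert (S < q * C) by nra.
assert (0 < x * c) by nra.
apply Rlt_trans with (s * S); [nra|].
replace (s * C * q) with (s * (q * C)) by ring. apply Rmult_lt_compat_l; lra.
Qed.

(** * The caustic *)

(** On the critical curve den x y = k R with R = |cos z|, whence
sinh y ^ 2 = (R^2 + k R - 1) / 2 and cos x ^ 2 = (R^2 - k R + 1) / 2.  The
imaginary part of the image is then y - cos x sinh y / R. *)
Definition caustic_height k R :=
  arcsinh (sqrt ((R ^ 2 + k * R - 1) / 2)) -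
  sqrt ((R ^ 2 - k * R + 1) / 2) * sqrt ((R ^ 2 + k * R - 1) / 2) / R.

Lemma gamma_pos k R : 0 < k < 2 -> 0 < (R ^ 2 - k * R + 1) / 2.
Proof.
intro h. assert (0 < (1 - k / 2) * (1 + k / 2)) by (apply Rmult_lt_0_compat; lra).
generalize (pow2_ge_0 (R - k / 2)). lra.
Qed.

Lemma is_derive_caustic_form (A p g : R -> R) (x a p' g' : R) :
  is_derive A (p x) a -> is_derive p x p' -> is_derive g x g' -> x <> 0 ->
  is_derive (fun t => A (p t) - g t * p t / t) x
    (a * p' - ((g' * p x + g x * p') / x - g x * p x / x ^ 2)).
Proof.
intros hA hp hg hx. auto_derive.
- assert (ex_derive (fun t : R => A t) (p x)) by (exists a; exact hA).
  assert (ex_derive (fun t : R => p t) x) by (exists p'; exact hp).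
  assert (ex_derive (fun t : R => g t) x) by (exists g'; exact hg).
  tauto.
- replace (Derive (fun t : R => A t) (p x)) with a
    by (symmetry; apply is_derive_unique; exact hA).
  replace (Derive (fun t : R => p t) x) with p'
    by (symmetry; apply is_derive_unique; exact hp).
  replace (Derive (fun t : R => g t) x) with g'
    by (symmetry; apply is_derive_unique; exact hg).
  field; auto.
Qed.

Lemma caustic_derive k R : 0 < k < 2 -> 0 < R -> 1 < R ^ 2 + k * R ->
  let p := sqrt ((R ^ 2 + k * R - 1) / 2) in
  let g := sqrt ((R ^ 2 - k * R + 1) / 2) in
  let h := sqrt ((R ^ 2 + k * R + 1) / 2) in
  is_derive (caustic_height k) R
   (((2 * R + k) * g * R ^ 2 - h * (R ^ 4 - k * R + 1)) / (4 * p * g * h * R ^ 2)).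
Proof.
intros hk hR hP p g h. unfold caustic_height.
assert (hp : 0 < p) by (apply sqrt_lt_R0; lra).
assert (hg : 0 < g) by (apply sqrt_lt_R0; now apply gamma_pos).
assert (hh : 0 < h) by (apply sqrt_lt_R0; lra).
assert (p2 : p ^ 2 = (R ^ 2 + k * R - 1) / 2) by (apply pow2_sqrt; lra).
assert (g2 : g ^ 2 = (R ^ 2 - k * R + 1) / 2) by (apply pow2_sqrt; left; now apply gamma_pos).
assert (h2 : h ^ 2 = (R ^ 2 + k * R + 1) / 2) by (apply pow2_sqrt; lra).
assert (D1 : is_derive (fun R => sqrt ((R ^ 2 + k * R - 1) / 2)) R ((2 * R + k) / (4 * p))).
{ replace ((2 * R + k) / (4 * p)) with (((2 * R + k) / 2) / (2 * p)) by (field; lra).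
  apply (is_derive_sqrt (fun R => (R ^ 2 + k * R - 1) / 2)); [auto_derive; auto; field|lra]. }
assert (D2 : is_derive (fun R => sqrt ((R ^ 2 - k * R + 1) / 2)) R ((2 * R - k) / (4 * g))).
{ replace ((2 * R - k) / (4 * g)) with (((2 * R - k) / 2) / (2 * g)) by (field; lra).
  apply (is_derive_sqrt (fun R => (R ^ 2 - k * R + 1) / 2));
    [auto_derive; auto; field|now apply gamma_pos]. }
assert (D3 : is_derive arcsinh p (/ h)).
{ apply is_derive_Reals. replace h with (sqrt (p ^ 2 + 1)).
  - apply derivable_pt_lim_arcsinh.
  - unfold h. f_equal. rewrite p2. field. }
assert (D4 := is_derive_caustic_form arcsinh (fun R => sqrt ((R ^ 2 + k * R - 1) / 2))
  (fun R => sqrt ((R ^ 2 - k * R + 1) / 2)) R _ _ _ D3 D1 D2 (Rgt_not_eq _ _ hR)).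
cbv beta in D4. fold p g in D4.
match type of D4 with is_derive _ _ ?l => match goal with |- is_derive _ _ ?r => replace r with l end end;
 [exact D4|].
apply Rmult_eq_reg_r with (4 * p * g * h * R ^ 2).
2: { assert (0 < 4 * p * g * h * R ^ 2) by (repeat apply Rmult_lt_0_compat; lra || nra). lra. }
field_simplify; try lra.
replace (p ^ 2) with ((R ^ 2 + k * R - 1) / 2). replace (g ^ 2) with ((R ^ 2 - k * R + 1) / 2). field.
Qed.

(** Squaring the equation for a zero of the derivative gives a polynomial
equation in R, which splits into the factors R^2 + 1, R^2 + k R - 1 and
(4 - k^2) R^2 - (R^2 - 1)^3, the first two of which are positive. *)
Lemma caustic_critical k R : 0 < k < 2 -> 0 < R -> 1 < R ^ 2 + k * R ->
  is_derive (caustic_height k) R 0 -> (R ^ 2 - 1) ^ 3 = (4 - k ^ 2) * R ^ 2.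
Proof.
intros hk hR hP h0.
assert (D := caustic_derive k R hk hR hP). cbv zeta in D.
set (p := sqrt ((R ^ 2 + k * R - 1) / 2)) in *.
set (g := sqrt ((R ^ 2 - k * R + 1) / 2)) in *.
set (h := sqrt ((R ^ 2 + k * R + 1) / 2)) in *.
assert (hp : 0 < p) by (apply sqrt_lt_R0; lra).
assert (hg : 0 < g) by (apply sqrt_lt_R0; now apply gamma_pos).
assert (hh : 0 < h) by (apply sqrt_lt_R0; lra).
assert (g2 : g ^ 2 = (R ^ 2 - k * R + 1) / 2) by (apply pow2_sqrt; left; now apply gamma_pos).
assert (h2 : h ^ 2 = (R ^ 2 + k * R + 1) / 2) by (apply pow2_sqrt; lra).
apply is_derive_unique in h0. apply is_derive_unique in D. rewrite h0 in D.
assert (hd : 0 < 4 * p * g * h * R ^ 2) by (repeat apply Rmult_lt_0_compat; lra || nra).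
assert (E : (2 * R + k) * g * R ^ 2 = h * (R ^ 4 - k * R + 1)).
{ apply Rminus_diag_uniq. apply Rmult_eq_reg_r with (/ (4 * p * g * h * R ^ 2)).
  - rewrite Rmult_0_l. symmetry. exact D.
  - apply Rinv_neq_0_compat. lra. }
assert (E2 : (2 * R + k) ^ 2 * R ^ 4 * g ^ 2 = h ^ 2 * (R ^ 4 - k * R + 1) ^ 2).
{ transitivity (((2 * R + k) * g * R ^ 2) ^ 2); [ring|]. rewrite E. ring. }
rewrite g2, h2 in E2.
assert (F : (R ^ 2 + 1) * (R ^ 2 + k * R - 1) *
   ((4 - k ^ 2) * R ^ 2 - (R ^ 2 - 1) ^ 3) = 0) by lra.
apply Rmult_integral in F. destruct F as [F|F]; [|lra].
apply Rmult_integral in F. destruct F as [F|F]; nra.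
Qed.

(** A solution exceeds 1, and (s - 1)^3 / s increases there. *)
Lemma critical_unique m s t : 0 < m -> 0 < s -> s < t ->
  (s - 1) ^ 3 = m * s -> (t - 1) ^ 3 = m * t -> False.
Proof.
intros hm hs st e1 e2.
assert (h1 : 0 < s - 1).
{ apply Rnot_le_lt. intro n. assert (0 < m * s) by nra.
  assert (0 <= (1 - s) ^ 3) by (apply pow_le; lra).
  replace ((s - 1) ^ 3) with (- (1 - s) ^ 3) in e1 by ring. lra. }
assert (e3 : (s - 1) ^ 3 * t = (t - 1) ^ 3 * s) by (rewrite e1, e2; ring).
remember (s - 1) as a. remember (t - 1) as b.
replace t with (b + 1) in e3 by lra. replace s with (a + 1) in e3 by lra.
assert (a < b) by lra.
assert (a ^ 3 < b ^ 3) by nra.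
assert (0 < a * b * (b - a) * (b + a)) by (repeat apply Rmult_lt_0_compat; lra).
nra.
Qed.

Lemma critical_on_caustic k v y : 0 < k -> 0 < y -> v < y -> (y - v) * sinh y < k ->
  is_derive (branch_re k v) y 0 ->
  exists R, 0 < R /\ 1 < R ^ 2 + k * R /\ sinh y ^ 2 = (R ^ 2 + k * R - 1) / 2 /\
    caustic_height k R = v.
Proof.
intros hk hy hv h hd.
destruct (branch_cos_interior k v y) as [c0 c1]; auto; try lra.
assert (hc : -1 < branch_cos k v y < 1) by lra.
assert (E := critical_eq k v y hk hy hc hd).
generalize (branch_cos_quad k v y hk hy) (sinh_pos y hy) (cosh2 y).
set (c := branch_cos k v y) in *. set (S := sinh y) in *. set (C := cosh y) in *.
set (q := y - v). intros Q hS h2.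
exists (sqrt (c ^ 2 + S ^ 2)). set (R := sqrt _).
assert (hp : 0 < c ^ 2 + S ^ 2) by nra.
assert (hR : 0 < R) by (now apply sqrt_lt_R0).
assert (R2 : R ^ 2 = c ^ 2 + S ^ 2) by (apply pow2_sqrt; lra).
assert (D : C ^ 2 - c ^ 2 = k * R).
{ assert (0 < k * R) by nra. assert (0 < C ^ 2 - c ^ 2) by nra.
  rewrite <- R2 in E. assert ((C ^ 2 - c ^ 2 - k * R) * (C ^ 2 - c ^ 2 + k * R) = 0) by nra.
  apply Rmult_integral in H1. lra. }
assert (S2 : S ^ 2 = (R ^ 2 + k * R - 1) / 2) by lra.
assert (c2 : c ^ 2 = (R ^ 2 - k * R + 1) / 2) by lra.
split; [auto|]. split; [nra|]. split; [auto|].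
unfold caustic_height. rewrite <- S2, <- c2, !sqrt_pow2 by lra.
unfold S at 1. rewrite arcsinh_sinh.
assert (F : q * R = S * c).
{ apply Rmult_eq_reg_l with k; [|lra].
  replace (k * (q * R)) with (q * (C ^ 2 - c ^ 2)) by (rewrite D; ring). lra. }
assert (G : c * S / R = q) by (apply Rmult_eq_reg_r with R; [field_simplify|]; lra).
rewrite G. unfold q; ring.
Qed.

(** Three critical points on the curve would give three values of R with the
same caustic_height, and two distinct critical points of caustic_height between
them. *)
Lemma upper_critical_points k v b : 0 < k < 2 -> 0 < v -> (b - v) * sinh b <= k ->
  at_most_two_critical (branch_re k v) v b.
Proof.
intros hk hv hb x1 x2 x3 l1 l2 l3 l4 d1 d2 d3.
assert (M : forall x, v < x -> x < b -> (x - v) * sinh x < k).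
{ intros x l l'. apply Rlt_le_trans with (2 := hb). apply mul_sinh_mono; lra. }
destruct (critical_on_caustic k v x1) as [R1 [p1 [q1 [e1 w1]]]]; auto; try lra; try (apply M; lra).
destruct (critical_on_caustic k v x2) as [R2 [p2 [q2 [e2 w2]]]]; auto; try lra; try (apply M; lra).
destruct (critical_on_caustic k v x3) as [R3 [p3 [q3 [e3 w3]]]]; auto; try lra; try (apply M; lra).
assert (s1 : 0 < sinh x1) by (apply sinh_pos; lra).
assert (s2 := sinh_lt _ _ l2). assert (s3 := sinh_lt _ _ l3).
assert (o1 : R1 < R2) by (apply Rnot_le_lt; intro n; nra).
assert (o2 : R2 < R3) by (apply Rnot_le_lt; intro n; nra).
assert (P : forall R, R1 <= R -> 0 < R /\ 1 < R ^ 2 + k * R) by (intros; split; nra).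
assert (roll : forall a b, R1 <= a -> a < b -> caustic_height k a = caustic_height k b ->
  exists c, a < c < b /\ (c ^ 2 - 1) ^ 3 = (4 - k ^ 2) * c ^ 2).
{ intros a d ha had e.
  destruct (rolle (caustic_height k) a d) as [c [hc hd]]; auto.
  - intros x hx. destruct (P x) as [h1 h2]; [lra|].
    apply (ex_derive_continuous (caustic_height k)). eexists. now apply caustic_derive.
  - intros x hx. destruct (P x) as [h1 h2]; [lra|]. eexists. now apply caustic_derive.
  - exists c; split; auto. destruct (P c) as [h1 h2]; [lra|]. now apply caustic_critical. }
destruct (roll R1 R2) as [c1 [h1 f1]]; try lra.
destruct (roll R2 R3) as [c2 [h2 f2]]; try lra.
apply (critical_unique (4 - k ^ 2) (c1 ^ 2) (c2 ^ 2)); auto; nra.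
Qed.

(** * Solutions off the real axis *)

Lemma sinh_ge y : 0 <= y -> y <= sinh y.
Proof.
intros [hy| <-]; [|rewrite sinh_0; lra].
destruct (MVT_cor2 sinh cosh 0 y hy) as [c [e hc]].
- intros c _. apply derivable_pt_lim_sinh.
- rewrite sinh_0 in e. generalize (cosh_ge1 c). nra.
Qed.

(** The point b is the end of the curve: there branch_cos k v b = 1, and the curve
meets the imaginary axis. *)
Lemma end_exists k v : 0 < k -> exists b, 0 < b /\ v < b /\ (b - v) * sinh b = k.
Proof.
intro hk. set (a := Rmax 0 v).
assert (a0 : 0 <= a) by apply Rmax_l. assert (av : v <= a) by apply Rmax_r.
destruct (ivt_up (fun y => (y - v) * sinh y) a (a + 1 + k) k) as [b [hb e]]; try lra.
- intros x _. apply (ex_derive_continuous (fun y => (y - v) * sinh y)). auto_derive. auto.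
- unfold a, Rmax. destruct (Rle_dec 0 v); [|rewrite sinh_0]; lra.
- assert (1 + k <= (a + 1 + k - v)) by lra.
  assert (1 <= sinh (a + 1 + k)) by (apply Rle_trans with (a + 1 + k); [lra|apply sinh_ge; lra]).
  nra.
- exists b. repeat split; auto; lra.
Qed.

Lemma branch_cos_end k v b : 0 < k -> 0 < b -> v < b -> (b - v) * sinh b = k -> branch_cos k v b = 1.
Proof.
intros hk hb hv e. destruct (branch_cos_sub1 k v b) as [m [_ em]]; auto; try lra.
rewrite e, Rminus_diag, Rmult_0_r in em. lra.
Qed.

Lemma le_end_iff k v b y : 0 < y -> v < y -> v < b -> (b - v) * sinh b = k ->
  0 < b -> ((y - v) * sinh y <= k <-> y <= b).
Proof.
intros hy hv hvb e hb. split; intro h.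
- apply Rnot_lt_le. intro n. assert (H := mul_sinh_mono v b y). lra.
- destruct h as [h| ->]; [|lra]. assert (H := mul_sinh_mono v y b). lra.
Qed.

(** For y > 0 the imaginary equation forces v < y, as k cos x sinh y > 0. *)
Lemma solution_up k u v x y : 0 < k -> 0 < y ->
  (is_solution k (u, v) (x, y) <->
   v < y /\ (y - v) * sinh y <= k /\
   (x = branch_x k v y /\ branch_re k v y = u \/ x = - branch_x k v y /\ branch_re k v y = - u)).
Proof.
intros hk hy. rewrite is_solution_iff. split.
- intros [_ [hx [h1 h2]]].
  assert (hv : v < y).
  { unfold lens2 in h2. assert (0 < k * cos x * sinh y / den x y).
    { apply Rdiv_lt_0_compat; [|now apply den_posy].
      apply Rmult_lt_0_compat; [|now apply sinh_pos].
      apply Rmult_lt_0_compat; auto. now apply cos_pos_strip. }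
    lra. }
  apply branch_iff in h2; auto. destruct h2 as [h e].
  split; auto. split; auto. unfold branch_re. rewrite <- e. unfold Rabs.
  destruct (Rcase_abs x); [right|left]; split; try lra.
  rewrite lens1_oppx. lra.
- intros [hv [h hx]].
  assert (hc : 0 < branch_cos k v y <= 1)
    by (split; [now apply branch_cos_pos|apply branch_cos_le1; auto; lra]).
  assert (a : Rabs x = branch_x k v y).
  { destruct (branch_x_range k v y). destruct hx as [[-> _]|[-> _]]; [|rewrite Rabs_Ropp];
    apply Rabs_pos_eq; lra. }
  assert (hx2 : Rabs x < PI / 2) by (rewrite a; now apply branch_x_lt).
  split; [intro E; injection E; lra|]. split; auto. split.
  + unfold branch_re in hx. destruct hx as [[-> e]|[-> e]]; auto. rewrite lens1_oppx. lra.
  + apply branch_iff; auto.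
Qed.

Lemma solution_down k u v x y : is_solution k (u, v) (x, - y) <-> is_solution k (u, - v) (x, y).
Proof.
rewrite !is_solution_iff, lens1_oppy, lens2_oppy.
assert ((x, - y) = (0, 0) <-> (x, y) = (0, 0)).
{ split; intro E; injection E; intros; f_equal; lra. }
assert (- lens2 k x y = v <-> lens2 k x y = - v) by (split; lra).
tauto.
Qed.

(** lower_neg leaves only the end of the curve. *)
Lemma lower_solution_axis k v b x y : 0 < k -> v <= 0 -> 0 < b -> (b - v) * sinh b = k -> 0 < y ->
  (is_solution k (0, v) (x, y) <-> x = 0 /\ y = b).
Proof.
intros hk hv hb e hy. rewrite solution_up by auto. rewrite Ropp_0.
rewrite (le_end_iff k v b y) by (auto; lra).
split.
- intros [_ [l h]].
  assert (branch_re k v y = 0) by tauto.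
  assert (y = b) as ->.
  { destruct l as [l|l]; auto. assert (branch_re k v y < 0); [|lra].
    apply lower_neg; auto. rewrite <- e. apply mul_sinh_mono; lra. }
  split; auto. rewrite branch_x_end in h by (apply branch_cos_end; auto; lra). lra.
- intros [-> ->]. split; [lra|]. split; [lra|]. left.
  assert (branch_cos k v b = 1) by (apply branch_cos_end; auto; lra).
  rewrite branch_x_end, branch_re_end; auto.
Qed.

(** Injectivity of branch_re k v singles out t, and since branch_re k v is not positive,
only the curve with x <= 0 contributes. *)
Lemma lower_solution k v t x y : 0 < k -> v <= 0 -> 0 < t -> (t - v) * sinh t < k -> 0 < y ->
  (is_solution k (- branch_re k v t, v) (x, y) <-> x = - branch_x k v t /\ y = t).
Proof.
intros hk hv ht h hy. rewrite solution_up by auto.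
assert (n : branch_re k v t < 0) by (now apply lower_neg).
split.
- intros [_ [l hx]].
  assert (m : branch_re k v y <= 0).
  { destruct l as [l|l];
      [left; apply lower_neg; auto|right; apply branch_re_end, branch_cos_end; auto; lra]. }
  destruct hx as [[_ hx]|[hx e]]; [lra|]. rewrite Ropp_involutive in e.
  assert (y = t) as ->; auto.
  destruct (Rtotal_order y t) as [o|[o|o]]; auto; exfalso.
  + apply (lower_inj k v y t); auto; lra.
  + apply (lower_inj k v t y); auto; lra.
- intros [-> ->]. split; [lra|]. split; [lra|]. right. split; auto; lra.
Qed.

(** * Real w: up to four solutions *)

Lemma solution_real k u x : 0 < k ->
  (is_solution k (u, 0) (x, 0) <->
   0 < x < PI / 2 /\ (x - u) * sin x = k \/ 0 < - x < PI / 2 /\ (- x + u) * sin (- x) = k).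
Proof.
intro hk. rewrite is_solution_iff.
unfold lens1, lens2, den. rewrite sinh_0, cosh_0, sin_neg.
assert (E : sin x <> 0 -> (x - k * sin x * 1 / (sin x ^ 2 + 0 ^ 2) = u <-> (x - u) * sin x = k)).
{ intro n. replace (x - k * sin x * 1 / (sin x ^ 2 + 0 ^ 2)) with (x - k / sin x)
    by (field; auto).
  split; intro e.
  - rewrite <- e. field; auto.
  - rewrite <- e. field; auto. }
split.
- intros [n [hx [h1 _]]].
  assert (nx : x <> 0) by (intros ->; auto).
  assert (ns := sin_neq0 x hx nx). apply E in h1; auto. apply Rabs_def2 in hx.
  destruct (Rlt_dec 0 x); [left|right]; split; lra.
- intro h.
  assert (hx : Rabs x < PI / 2) by (apply Rabs_def1; lra).
  assert (nx : x <> 0) by lra.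
  split; [congruence|]. split; auto. split.
  + apply E; [now apply sin_neq0|]. lra.
  + unfold Rdiv; ring.
Qed.

Lemma mul_sin_mono u x y : 0 <= u -> 0 < x -> x < y -> y < PI / 2 -> (x + u) * sin x < (y + u) * sin y.
Proof.
intros hu hx hy hp.
assert (0 < sin x) by (apply sin_gt_0; lra).
assert (sin x < sin y) by (apply sin_increasing_1; lra). nra.
Qed.

Lemma real_root k u : 0 < k -> 0 <= u -> k < PI / 2 + u ->
  exists r, 0 < r < PI / 2 /\ (r + u) * sin r = k.
Proof.
intros hk hu h. generalize PI2_RGT_0; intro.
destruct (ivt_up (fun x => (x + u) * sin x) 0 (PI / 2) k) as [r [hr e]]; auto.
- intros x _. apply (ex_derive_continuous (fun x => (x + u) * sin x)). auto_derive; auto.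
- rewrite sin_0; lra.
- rewrite sin_PI2; lra.
- exists r; auto.
Qed.

Lemma real_uniq k u r x : 0 <= u -> 0 < r < PI / 2 -> (r + u) * sin r = k ->
  0 < x < PI / 2 -> (x + u) * sin x = k -> x = r.
Proof.
intros hu hr er hx ex.
destruct (Rtotal_order x r) as [o|[o|o]]; auto; exfalso.
- generalize (mul_sin_mono u x r); lra.
- generalize (mul_sin_mono u r x); lra.
Qed.

Lemma real_none u x : 0 <= u -> 0 < x < PI / 2 -> (x - u) * sin x <> PI / 2.
Proof.
intros hu hx. assert (0 < sin x) by (apply sin_gt_0; lra). generalize (SIN_bound x). nra.
Qed.

Ltac nodup := repeat constructor; simpl; let H := fresh in intro H;
  repeat (destruct H as [H|H]; [injection H; intros; lra|]); try contradiction.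

Lemma by_sign (P : R -> R -> Prop) : (forall x y, 0 < y -> P x y) -> (forall x y, 0 < y -> P x (- y)) ->
  (forall x, P x 0) -> forall x y, P x y.
Proof.
intros h1 h2 h3 x y. destruct (Rtotal_order y 0) as [o|[->|o]]; auto.
rewrite <- (Ropp_involutive y). apply h2; lra.
Qed.

Lemma pair_iff (a b x y : R) : (a, b) = (x, y) <-> x = a /\ y = b.
Proof. split; [intro E; injection E; auto|intros [-> ->]; auto]. Qed.

(** For w = 0 each half-plane has one solution on the imaginary axis, and the
real solutions satisfy x sin x = k, which is impossible for k = PI / 2. *)
Lemma exactly_two : exists k w, 0 < k /\ exactly 2 (is_solution k w).
Proof.
assert (hk := PI2_RGT_0). destruct (end_exists (PI / 2) 0 hk) as [b [hb [_ e]]].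
exists (PI / 2), (0, 0). split; auto. exists [(0, b); (0, - b)].
split; [nodup|]. split; auto. intros [x y]. cbn [In]. rewrite !pair_iff. revert x y.
apply by_sign.
- intros x y hy. rewrite (lower_solution_axis _ 0 b) by (auto; lra). intuition lra.
- intros x y hy. rewrite solution_down, Ropp_0, (lower_solution_axis _ 0 b) by (auto; lra). intuition lra.
- intro x. rewrite solution_real by auto. generalize (real_none 0 x) (real_none 0 (- x)).
  rewrite !Rplus_0_r, !Rminus_0_r. intuition lra.
Qed.

(** For w = 0 and k = 1 the real solutions satisfy x sin x = 1: there are two. *)
Lemma exactly_four : exists k w, 0 < k /\ exactly 4 (is_solution k w).
Proof.
assert (hk := Rlt_0_1). destruct (end_exists 1 0 hk) as [b [hb [_ e]]].
destruct (real_root 1 0) as [r [hr er]]; try lra. { generalize PI2_1; lra. }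
exists 1, (0, 0). split; auto. exists [(0, b); (0, - b); (r, 0); (- r, 0)].
split; [nodup|]. split; auto. intros [x y]. cbn [In]. rewrite !pair_iff. revert x y.
apply by_sign.
- intros x y hy. rewrite (lower_solution_axis _ 0 b) by (auto; lra). intuition lra.
- intros x y hy. rewrite solution_down, Ropp_0, (lower_solution_axis _ 0 b) by (auto; lra). intuition lra.
- intro x. rewrite solution_real by auto. split.
  + intros [h|[h|[[-> _]|[[-> _]|[]]]]]; [lra|lra|lra|].
    right. rewrite !Ropp_involutive. auto.
  + intros [[hx ex]|[hx ex]].
    * assert (x = r); [|intuition lra]. apply (real_uniq 1 0); lra.
    * assert (- x = r); [|intuition lra]. apply (real_uniq 1 0); lra.
Qed.

(** With u chosen among the values of - branch_re, each half-plane has one solution,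
and there is one negative real solution. *)
Lemma exactly_three : exists k w, 0 < k /\ exactly 3 (is_solution k w).
Proof.
assert (hk := PI2_RGT_0). destruct (end_exists (PI / 2) 0 hk) as [b [hb [_ e]]].
set (t := b / 2). assert (ht : 0 < t) by (unfold t; lra).
assert (h : (t - 0) * sinh t < PI / 2) by (rewrite <- e; apply mul_sinh_mono; unfold t; lra).
assert (n := lower_neg (PI / 2) 0 t hk (Rle_refl 0) ht h).
set (u := - branch_re (PI / 2) 0 t). assert (hu : 0 < u) by (unfold u; lra).
destruct (real_root (PI / 2) u) as [r [hr er]]; try lra.
exists (PI / 2), (u, 0). split; auto.
exists [(- branch_x (PI / 2) 0 t, t); (- branch_x (PI / 2) 0 t, - t); (- r, 0)].
split; [nodup|]. split; auto. intros [x y]. cbn [In]. rewrite !pair_iff. revert x y.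
apply by_sign.
- intros x y hy. unfold u. rewrite lower_solution by (auto; lra). intuition lra.
- intros x y hy. unfold u. rewrite solution_down, Ropp_0, lower_solution by (auto; lra). intuition lra.
- intro x. rewrite solution_real by auto. split.
  + intros [h'|[h'|[[-> _]|[]]]]; [lra|lra|]. right. rewrite !Ropp_involutive. auto.
  + intros [[hx ex]|[hx ex]].
    * exfalso. apply (real_none u x); lra.
    * assert (- x = r); [|intuition lra]. apply (real_uniq (PI / 2) u); lra.
Qed.

(** The quadratic equation gives y cosh y <= (1 + k) c sinh y for
c = branch_cos k 0 y. *)
Lemma lower_bounded_re k y : 0 < k -> 0 < y -> (y - 0) * sinh y <= k -> - (1 + k) < branch_re k 0 y.
Proof.
intros hk hy h.
assert (hc : 0 < branch_cos k 0 y <= 1)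
  by (split; [now apply branch_cos_pos|apply branch_cos_le1; auto; lra]).
rewrite branch_re_eq by auto.
destruct (branch_x_range k 0 y) as [hX hX'].
assert (hs0 : 0 <= sin (branch_x k 0 y)) by (apply sin_ge_0; lra).
destruct hX as [hX|hX].
2: { rewrite <- hX, sin_0. unfold Rdiv. rewrite !Rmult_0_l. lra. }
generalize (SIN_bound (branch_x k 0 y)) (branch_cos_quad k 0 y hk hy)
  (sinh_pos y hy) (cosh_ge1 y) (sinh_ge y (Rlt_le _ _ hy)).
rewrite Rminus_0_r.
set (c := branch_cos k 0 y) in *. set (S := sinh y) in *. set (C := cosh y). set (s := sin _) in *.
intros hs Q hS hC hSy.
assert (s * C * y / (c * S) <= 1 + k); [|lra].
assert (0 < c * S) by (apply Rmult_lt_0_compat; lra).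
apply <- Rle_div_l; auto.
assert (0 < C * y) by (apply Rmult_lt_0_compat; lra).
apply Rle_trans with (C * y); [nra|].
assert (C * y <= C * (C * y)) by nra.
assert (y * c ^ 2 <= y * c) by (apply Rmult_le_compat_l; nra).
assert (y * c <= S * c) by (apply Rmult_le_compat_r; lra).
lra.
Qed.

(** A large u is beyond the range of - branch_re, and only the negative real solution
remains. *)
Lemma exactly_one : exists k w, 0 < k /\ exactly 1 (is_solution k w).
Proof.
assert (hk := PI2_RGT_0). set (k := PI / 2) in *. set (u := 1 + k). assert (hu : 0 < u) by (unfold u; lra).
destruct (real_root k u) as [r [hr er]]; try (unfold k in *; lra).
exists k, (u, 0). split; auto.
assert (none : forall x y, 0 < y -> ~ is_solution k (u, 0) (x, y)).
{ intros x y hy. rewrite solution_up by auto. intros [_ [l h]].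
  assert (b := lower_bounded_re k y hk hy l).
  assert (m : branch_re k 0 y <= 0).
  { destruct l as [l|l];
      [left; apply lower_neg; auto; lra|right; apply branch_re_end, branch_cos_end; auto]. }
  unfold u in *. lra. }
exists [(- r, 0)].
split; [nodup|]. split; auto. intros [x y]. cbn [In]. rewrite !pair_iff. revert x y.
apply by_sign.
- intros x y hy. generalize (none x y hy). intuition lra.
- intros x y hy. rewrite solution_down, Ropp_0. generalize (none x y hy). intuition lra.
- intro x. rewrite solution_real by auto. split.
  + intros [[-> _]|[]]. right. rewrite !Ropp_involutive. auto.
  + intros [[hx ex]|[hx ex]].
    * exfalso. apply (real_none u x); unfold k in *; lra.
    * left. assert (- x = r); [|lra]. apply (real_uniq k u); lra.
Qed.

(** * Five and six solutions *)

Lemma PI_upper : PI < 3.18.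
Proof.
destruct (PI_2_3_7_ineq 1) as [_ h].
unfold tg_alt, PI_2_3_7_tg, Ratan_seq in h. simpl in h. lra.
Qed.

(** Since den x y >= sinh y ^ 2 and sin x < x, the value of branch_re exceeds
x (1 - k cosh y / sinh y ^ 2), where x = branch_x k v y. *)
Lemma branch_re_pos k v y : 0 < k -> 0 < y -> v < y -> (y - v) * sinh y < k ->
  k * cosh y < sinh y ^ 2 -> 0 < branch_re k v y.
Proof.
intros hk hy hv h hS. destruct (branch_cos_interior k v y) as [c0 c1]; auto.
assert (hX : 0 < branch_x k v y) by (apply branch_x_pos; lra).
destruct (branch_x_range k v y) as [_ hX']. unfold branch_re, lens1.
set (x := branch_x k v y) in *. clearbody x.
assert (hs := sin_lt_x x hX). assert (hs0 : 0 < sin x) by (now apply sin_gt_0).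
assert (hD : sinh y ^ 2 <= den x y) by (unfold den; generalize (pow2_ge_0 (sin x)); lra).
assert (hC := cosh_pos y). assert (0 < k * cosh y) by (now apply Rmult_lt_0_compat).
apply Rlt_0_minus. apply <- Rlt_div_l; [|lra].
apply Rlt_le_trans with (x * (k * cosh y)).
- replace (k * sin x * cosh y) with (sin x * (k * cosh y)) by ring.
  now apply Rmult_lt_compat_r.
- apply Rmult_le_compat_l; lra.
Qed.

Lemma negative_derivative (f : R -> R) a l e : is_derive f a l -> l < 0 -> 0 < e ->
  exists p, a < p < a + e /\ f p < f a.
Proof.
intros hf hl he. apply is_derive_Reals in hf.
destruct (hf (- l / 2)) as [d hd]; [lra|].
assert (d0 := cond_pos d).
set (h := Rmin d e / 2).
assert (h0 : 0 < h) by (unfold h; apply Rdiv_lt_0_compat; [apply Rmin_glb_lt|]; lra).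
assert (h1 : h < d) by (generalize (Rmin_l d e); unfold h in *; lra).
assert (h2 : h < e) by (generalize (Rmin_r d e); unfold h in *; lra).
exists (a + h). split; [lra|].
specialize (hd h (Rgt_not_eq _ _ h0)). rewrite Rabs_pos_eq in hd by lra.
specialize (hd h1). apply Rabs_def2 in hd.
assert (q : (f (a + h) - f a) / h < 0) by lra.
apply Rlt_div_l in q; [|lra]. lra.
Qed.

Lemma branch_cos_start k v : branch_cos k v v = 0.
Proof. unfold branch_cos, Rdiv. rewrite Rminus_diag. ring. Qed.

Lemma branch_x_start k v : branch_x k v v = PI / 2.
Proof.
assert (h := PI_RGT_0). destruct (branch_x_range k v v).
apply cos_inj; try lra. rewrite cos_PI2, cos_branch_x, branch_cos_start; auto. rewrite branch_cos_start; lra.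
Qed.

Lemma branch_re_start k v : branch_re k v v = PI / 2 - k / cosh v.
Proof.
unfold branch_re, lens1. rewrite den_cos, branch_x_start, sin_PI2, cos_PI2. generalize (cosh_pos v). intro.
field. lra.
Qed.

Lemma continuous_in_k k v y : 0 < k -> 0 < y -> -1 < branch_cos k v y < 1 ->
  continuous (fun k => branch_re k v y) k.
Proof.
intros hk hy h. generalize (branch_cos_den k v y hk hy) (branch_cos_arg k v y hk hy). intros h1 h2.
assert (ec : ex_derive (fun k => branch_cos k v y) k).
{ unfold branch_cos. auto_derive. split; [exact h2|]. split; auto.
  match type of h1 with 0 < ?b => match goal with |- ?a <> 0 =>
    change a with b end end. lra. }
assert (ex : ex_derive (fun k => branch_x k v y) k).
{ unfold branch_x. auto_derive. repeat split; auto; try lra. apply Rdiv_lt_0_compat; lra. }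
apply (ex_derive_continuous (fun k => branch_re k v y)). unfold branch_re, lens1, den.
auto_derive. generalize (den_posy (branch_x k v y) y hy). unfold den. simpl. intro hD.
assert (sin (branch_x k v y) * (sin (branch_x k v y) * 1) + sinh y * (sinh y * 1) <> 0) by lra.
tauto.
Qed.

Lemma cosh_ln2 : cosh (ln 2) = 5 / 4.
Proof. unfold cosh. rewrite exp_Ropp, exp_ln by lra. lra. Qed.
Lemma sinh_ln2 : sinh (ln 2) = 3 / 4.
Proof. unfold sinh. rewrite exp_Ropp, exp_ln by lra. lra. Qed.

Lemma ln2_pos : 0 < ln 2.
Proof. generalize ln_lt_2; lra. Qed.

(** A point of the curve for v = ln 2 at which branch_re_pos applies: it must lie
before the end, (y - v) sinh y < k, and satisfy k cosh y < sinh y ^ 2.  For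
k close to 5 PI / 8 both hold at exp y = 4.6, with little room. *)
Definition ymid := ln 4.6.
Lemma cosh_ymid : cosh ymid = (4.6 + / 4.6) / 2.
Proof. unfold ymid, cosh. rewrite exp_Ropp, exp_ln by lra. lra. Qed.
Lemma sinh_ymid : sinh ymid = (4.6 - / 4.6) / 2.
Proof. unfold ymid, sinh. rewrite exp_Ropp, exp_ln by lra. lra. Qed.

Lemma ymid_gt : ln 2 < ymid.
Proof. apply ln_increasing; lra. Qed.

Lemma ymid_sub : ymid - ln 2 < 0.85.
Proof.
assert (E : ymid = ln 2 + ln 2.3) by (unfold ymid; rewrite <- ln_mult by lra; f_equal; lra).
assert (ln 2.3 < 0.85); [|lra].
apply exp_lt_inv. rewrite exp_ln by lra.
apply Rlt_le_trans with (2 := exp_ge_taylor 0.85 4 ltac:(lra)). simpl. lra.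
Qed.

Lemma ymid_height k : 1.865 <= k -> (ymid - ln 2) * sinh ymid < k.
Proof. intro h. assert (a := ymid_sub). assert (b := ymid_gt). rewrite sinh_ymid. nra. Qed.

Lemma ymid_lens k : 0 < k -> k <= 5 * PI / 8 -> k * cosh ymid < sinh ymid ^ 2.
Proof. intros h0 h. generalize PI_upper. rewrite cosh_ymid, sinh_ymid. nra. Qed.

Lemma upper_regular k v b : 0 < k -> 0 < v -> v < b -> (b - v) * sinh b = k ->
  (forall y, v <= y <= b -> continuous (branch_re k v) y) /\
  (forall y, v < y < b -> ex_derive (branch_re k v) y).
Proof.
intros hk hv hb e. split; intros y hy.
- apply continuous_branch_re; try lra.
  destruct (Req_dec v y) as [<-|]; [rewrite branch_cos_start; lra|].
  assert (0 < branch_cos k v y) by (apply branch_cos_pos; lra). lra.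
- destruct (branch_derive k v y) as [x' [H _]]; try lra.
  + destruct (branch_cos_interior k v y); try lra. rewrite <- e. apply mul_sinh_mono; lra.
  + eexists; exact H.
Qed.

(** At y = v = ln 2 the curve starts at the boundary point x = PI / 2 with
branch_re = 0, and there the Jacobian matrix has a = 0 and b = 3 PI / 10.  So the
derivative of branch_re is b - 1 / b, which is negative because b < 1. *)
Lemma start_dips : exists p, ln 2 < p < ymid /\ branch_re (5 * PI / 8) (ln 2) p < 0.
Proof.
assert (hp := PI_upper). assert (hp0 := PI_RGT_0). set (k := 5 * PI / 8). 
assert (hk : 0 < k) by (unfold k; lra).
assert (l0 := ln2_pos). assert (l1 := ymid_gt).
destruct (branch_derive k (ln 2) (ln 2)) as [x' [H1 H2]]; auto; [rewrite branch_cos_start; lra|].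
assert (ea : jac_a k (branch_x k (ln 2) (ln 2)) (ln 2) = 0).
{ unfold jac_a. rewrite branch_x_start, cos_PI2. unfold Rdiv; ring. }
assert (eb : jac_b k (branch_x k (ln 2) (ln 2)) (ln 2) = 3 * PI / 10).
{ unfold jac_b. rewrite den_cos, branch_x_start, cos_PI2, sin_PI2, cosh_ln2, sinh_ln2. unfold k. field. }
rewrite ea, eb in *.
destruct (negative_derivative _ _ _ (ymid - ln 2) H1) as [p [h e]]; try lra.
- assert (x' * (3 * PI / 10) = - 1) by lra. assert (x' < -1) by nra. lra.
- exists p. split; [lra|]. rewrite branch_re_start, cosh_ln2 in e. unfold k in *. lra.
Qed.

Lemma exactly_five : exists k w, 0 < k /\ exactly 5 (is_solution k w).
Proof.
assert (hp := PI_upper). assert (hp0 := PI2_3_2). set (k := 5 * PI / 8).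
assert (hk : 0 < k) by (unfold k; lra).
set (v := ln 2). assert (hv : 0 < v) by apply ln2_pos.
destruct (end_exists k v hk) as [b [hb [hvb eb]]].
destruct start_dips as [p [hpp fp]]. fold k v in fp. fold v in hpp.
assert (hm : (ymid - v) * sinh ymid < k) by (apply ymid_height; unfold k; lra).
assert (hmb : ymid < b).
{ apply Rnot_le_lt; intro n. destruct n as [n|n].
  - generalize (mul_sinh_mono v b ymid). lra.
  - rewrite <- n in hm. lra. }
assert (fm : 0 < branch_re k v ymid)
  by (apply branch_re_pos; auto; try lra; apply ymid_lens; unfold k in *; lra).
assert (fb : branch_re k v b = 0) by (apply branch_re_end, branch_cos_end; auto; lra).
destruct (end_exists k (- v) hk) as [d [hd [_ ed]]].
(* Any level below - branch_re k (- v) t0 is taken on the lower curve. *)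
set (t0 := d / 2).
assert (h0 : (t0 - - v) * sinh t0 < k) by (rewrite <- ed; apply mul_sinh_mono; unfold t0; lra).
assert (f0 : branch_re k (- v) t0 < 0) by (apply lower_neg; auto; unfold t0; lra).
set (m := Rmin (- branch_re k v p) (Rmin (branch_re k v ymid) (- branch_re k (- v) t0))).
assert (m0 : 0 < m) by (unfold m; repeat apply Rmin_glb_lt; lra).
assert (m1 : m <= - branch_re k v p) by apply Rmin_l.
assert (m2 : m <= branch_re k v ymid) by (eapply Rle_trans; [apply Rmin_r|apply Rmin_l]).
assert (m3 : m <= - branch_re k (- v) t0) by (eapply Rle_trans; [apply Rmin_r|apply Rmin_r]).
set (u := m / 2).
destruct (upper_regular k v b hk hv hvb eb) as [rc rd].
destruct (two_bumps (branch_re k v) v p ymid b rc rd) with (u := u)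
  as [z1 [z2 [z3 [z4 [o1 [o2 [o3 [o4 [o5 [Ed Eu]]]]]]]]]]; auto; try lra; try (unfold u; lra).
{ apply upper_critical_points; auto; [unfold k; lra|lra]. }
{ rewrite branch_re_start. unfold v. rewrite cosh_ln2. unfold k. field. }
destruct (ivt_up (branch_re k (- v)) t0 d (- u)) as [t [ht et]]; try (unfold t0; lra).
{ intros y hy. apply continuous_branch_re; auto; [unfold t0 in *; lra|].
  assert (0 < branch_cos k (- v) y) by (apply branch_cos_pos; unfold t0 in *; lra). lra. }
{ unfold u; lra. }
{ rewrite branch_re_end by (apply branch_cos_end; auto; lra). unfold u; lra. }
assert (htt : (t - - v) * sinh t < k) by (rewrite <- ed; apply mul_sinh_mono; unfold t0 in *; lra).
assert (t1 : 0 < t) by (unfold t0 in *; lra).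
exists k, (u, v). split; auto.
exists [(- branch_x k v z1, z1); (- branch_x k v z2, z2);
  (branch_x k v z3, z3); (branch_x k v z4, z4); (- branch_x k (- v) t, - t)].
split; [nodup|]. split; auto. intros [x y]. cbn [In]. rewrite !pair_iff. revert x y.
apply by_sign.
- intros x y hy. rewrite solution_up by auto. split.
  + intros [[-> ->]|[[-> ->]|[[-> ->]|[[-> ->]|[[_ h]|[]]]]]]; [| | | |lra];
     (split; [lra|]; split; [apply (le_end_iff k v b); auto; lra|]).
    * right. split; auto. apply Ed; auto; lra.
    * right. split; auto. apply Ed; auto; lra.
    * left. split; auto. apply Eu; auto; lra.
    * left. split; auto. apply Eu; auto; lra.
  + intros [hvy [l h]]. apply (le_end_iff k v b) in l; auto.
    destruct h as [[-> e]|[-> e]].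
    * apply Eu in e; [|lra]. destruct e as [->| ->]; auto 8.
    * apply Ed in e; [|lra]. destruct e as [->| ->]; auto 8.
- intros x y hy. rewrite solution_down. replace u with (- branch_re k (- v) t) by lra.
  rewrite lower_solution by (auto; lra). intuition lra.
- intro x. rewrite is_solution_iff. unfold lens2. rewrite sinh_0. unfold Rdiv. intuition lra.
Qed.

Lemma exactly_six : exists k w, 0 < k /\ exactly 6 (is_solution k w).
Proof.
assert (hp := PI_upper). assert (hp0 := PI2_3_2). set (k0 := 5 * PI / 8).
set (v := ln 2). assert (hv : 0 < v) by apply ln2_pos.
assert (hk0 : 0 < k0) by (unfold k0; lra).
destruct start_dips as [p [hpp fp]]. fold k0 v in fp. fold v in hpp.
assert (exists k, 1.865 <= k /\ k < k0 /\ branch_re k v p < 0) as [k [hk1 [hk2 fp']]].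
(* The dip at p survives a small decrease of k. *)
{ assert (hc : continuous (fun k => branch_re k v p) k0).
  { apply continuous_in_k; auto; [lra|].
    destruct (branch_cos_interior k0 v p); auto; try lra.
    apply Rlt_trans with ((ymid - v) * sinh ymid).
    - apply mul_sinh_mono; lra.
    - apply ymid_height. unfold k0; lra. }
  destruct (hc (fun t => t < 0) (open_lt 0 _ fp)) as [d hd].
  assert (d0 := cond_pos d).
  exists (k0 - Rmin (d / 2) (1 / 100)). 
  assert (Rmin (d / 2) (1 / 100) <= 1 / 100) by apply Rmin_r.
  assert (Rmin (d / 2) (1 / 100) <= d / 2) by apply Rmin_l.
  assert (0 < Rmin (d / 2) (1 / 100)) by (apply Rmin_glb_lt; lra).
  split; [unfold k0; lra|]. split; [lra|]. apply hd.
  change (Rabs (k0 - Rmin (d / 2) (1 / 100) - k0) < d). apply Rabs_def1; lra. }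
assert (hk : 0 < k) by lra.
destruct (end_exists k v hk) as [b [hb [hvb eb]]].
assert (hm : (ymid - v) * sinh ymid < k) by (apply ymid_height; lra).
assert (hmb : ymid < b).
{ apply Rnot_le_lt; intro n. destruct n as [n|n].
  - generalize (mul_sinh_mono v b ymid). lra.
  - rewrite <- n in hm. lra. }
assert (fm : 0 < branch_re k v ymid)
  by (apply branch_re_pos; auto; try lra; apply ymid_lens; unfold k0 in *; lra).
assert (eb1 : branch_cos k v b = 1) by (apply branch_cos_end; auto; lra).
assert (fb : branch_re k v b = 0) by (now apply branch_re_end).
destruct (end_exists k (- v) hk) as [d [hd [_ ed]]].
destruct (upper_regular k v b hk hv hvb eb) as [rc rd].
destruct (two_zeros (branch_re k v) v p ymid b rc rd)
  as [z1 [z2 [o1 [o2 [o3 E]]]]]; auto; try lra.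
{ apply upper_critical_points; auto; [unfold k0 in *; lra|lra]. }
{ rewrite branch_re_start. unfold v. rewrite cosh_ln2. unfold k0 in *. lra. }
assert (X : forall z, v < z < b -> 0 < branch_x k v z).
{ intros z hz. apply branch_x_pos. destruct (branch_cos_interior k v z); auto; try lra.
  rewrite <- eb. apply mul_sinh_mono; lra. }
assert (X1 : 0 < branch_x k v z1) by (apply X; lra).
assert (X2 : 0 < branch_x k v z2) by (apply X; lra).
exists k, (0, v). split; auto.
exists [(branch_x k v z1, z1); (- branch_x k v z1, z1);
  (branch_x k v z2, z2); (- branch_x k v z2, z2); (0, b); (0, - d)].
split; [nodup|]. split; auto. intros [x y]. cbn [In]. rewrite !pair_iff. revert x y.
apply by_sign.
- intros x y hy. rewrite solution_up, Ropp_0 by auto. split.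
  + assert (Z1 : branch_re k v z1 = 0) by (apply E; auto; lra).
    assert (Z2 : branch_re k v z2 = 0) by (apply E; auto; lra).
    assert (X3 : branch_x k v b = 0) by (now apply branch_x_end).
    intros [[-> ->]|[[-> ->]|[[-> ->]|[[-> ->]|[[-> ->]|[[_ h]|[]]]]]]]; [| | | | |lra];
     (split; [lra|]; split; [apply (le_end_iff k v b); auto; lra|]); auto.
  + intros [hvy [l h]]. apply (le_end_iff k v b) in l; auto.
    destruct (Req_dec y b) as [->|nb].
    * rewrite branch_x_end in h by auto. do 4 right. left. split; auto. lra.
    * assert (e : branch_re k v y = 0) by tauto. apply E in e; [|lra].
      destruct e as [->| ->]; tauto.
- intros x y hy. rewrite solution_down.
  rewrite (lower_solution_axis k (- v) d) by (auto; lra). intuition lra.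
- intro x. rewrite is_solution_iff. unfold lens2. rewrite sinh_0. unfold Rdiv. intuition lra.
Qed.

Theorem mainTheorem2 :
  forall n : nat, (1 <= n <= 6)%nat ->
  exists (k : R) (w : C), (0 < k)%R /\ exactly n (is_solution k w).
Proof.
intros n hn.
assert (n = 1 \/ n = 2 \/ n = 3 \/ n = 4 \/ n = 5 \/ n = 6)%nat
  as [->|[->|[->|[->|[->| ->]]]]] by lia.
- exact exactly_one.
- exact exactly_two.
- exact exactly_three.
- exact exactly_four.
- exact exactly_five.
- exact exactly_six.
Qed.
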